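(* Let $(X,f)$ be a quasi-continuous dynamical system. Suppose that $X$ is a Baire space with a countable $\pi$-base $\{P_n:n\ge 0\}$. Then the following conditions are equivalent: (1) There is a point $x\in X$ such that $\omega f(x)=X$ (property $\mathrm{DO}_{++}$). (2) For every nonempty open subset $U\subseteq X$ and every $k\in\mathbb N$, the set $\bigcup_{n\ge k}\operatorname{int}(f^{-n}(U))$ is dense in $X$. (3) The set $\{x\in X:\omega f(x)=X\}$ contains a dense $G_\delta$-set of $X$.
   Context: $\mathbb N$ denotes the set of nonnegative integers. A dynamical system is a pair $(X,f)$ where $X$ is a topological space (with at least two points) and $f:X\to X$ is a map, not necessarily continuous. A map $g:X\to Y$ between topological spaces is quasi-continuous if for every $x_0\in X$, every open neighbourhood $W$ of $g(x_0)$ and every open neighbourhood $U$ of $x_0$, there is a nonempty open set $V\subseteq U$ with $g(V)\subseteq W$. The system $(X,f)$ is quasi-continuous if $f^n$ is quasi-continuous for every $n\in\mathbb N$. The omega limit set is $\omega f(x)=\bigcap_{k\in\mathbb N}\overline{\{f^n(x):n\ge k\}}$. A $\pi$-base for $X$ is a family $\mathscr P$ of nonempty open subsets of $X$ such that every nonempty open $U\subseteq X$ contains some $P\in\mathscr P$. $f^{-n}(U)$ denotes the preimage of $U$ under $f^n$. *)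

(* Defs.v *)
From mathcomp Require Import all_boot.
From mathcomp Require Import boolp classical_sets functions.
From mathcomp Require Import topology borel_hierarchy.

Set Implicit Arguments.
Unset Strict Implicit.
Unset Printing Implicit Defensive.

Local Open Scope classical_set_scope.

Definition quasi_continuous (X Y : topologicalType) (g : X -> Y) : Prop :=
  forall (x0 : X) (W : set Y) (U : set X),
    open_nbhs (g x0) W -> open_nbhs x0 U ->
    exists V : set X, [/\ open V, V !=set0, V `<=` U & g @` V `<=` W].

Definition quasi_continuous_system (X : topologicalType) (f : X -> X) : Prop :=
  (exists x y : X, x <> y) /\ (forall n : nat, quasi_continuous (iter n f)).

Definition omega_limit (X : topologicalType) (f : X -> X) (x : X) : set X :=
  \bigcap_(k in [set: nat]) closure [set iter n f x | n in [set n | (k <= n)%N]].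

Definition baire_space (X : topologicalType) : Prop :=
  forall F : nat -> set X,
    (forall i, open (F i) /\ dense (F i)) -> dense (\bigcap_i F i).

Definition pi_base (X : topologicalType) (B : set (set X)) : Prop :=
  (forall A, B A -> open A /\ A !=set0) /\
  (forall U : set X, open U -> U !=set0 -> exists2 A, B A & A `<=` U).

(* Main.v *)
Require Import Defs.
From mathcomp Require Import all_boot.
From mathcomp Require Import boolp classical_sets functions.
From mathcomp Require Import topology borel_hierarchy.

Local Open Scope classical_set_scope.

(** The condition [omega_limit f x = setT] says that the orbit of [x] visits
every nonempty open set at arbitrarily late times ([omega_limit_setTP]), and
it suffices to test this on the members of a pi-base
([omega_limit_setT_pi_base]).

If such an [x] exists, let [U] and [V] be nonempty open sets. The orbit of [x]
enters [V] at some time [m], and enters [U] at some time [j >= m + k]; hence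
the point [iter m f x] of [V] is sent into [U] by [iter (j - m) f].
Quasi-continuity of that iterate spreads this single visit to a nonempty open
subset of [V], which is what replaces continuity in the classical argument
([late_visit_dense]).

Conversely, intersecting the dense open sets of the second condition over the
countably many pairs of a member [P i] of the pi-base and a lower bound [k]
gives a dense G-delta set because the space is Baire, and the orbits starting
in it visit every [P i] arbitrarily late ([late_visit_Gdelta]). *)

Lemma omega_limit_setTP {X : topologicalType} (f : X -> X) (x : X) :
  omega_limit f x = [set: X] <->
  (forall (U : set X) (k : nat), open U -> U !=set0 ->
    exists2 n, (k <= n)%N & U (iter n f x)).
Proof.
split=> [omegaT U k oU [y Uy]|visit].
  have /(_ k I) : omega_limit f x y by rewrite omegaT.
  move=> /(_ U (open_nbhs_nbhs (conj oU Uy))) [_ [[n kn <-] Un]].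
  by exists n.
apply/seteqP; split=> // y _ k _ B; rewrite nbhsE => -[U [oU Uy] UB].
have [n kn Un] := visit U k oU (ex_intro _ y Uy).
by exists (iter n f x); split; [exists n|exact: UB].
Qed.

Lemma omega_limit_setT_pi_base {X : topologicalType} (f : X -> X)
    (B : set (set X)) (x : X) : pi_base B ->
  (forall (A : set X) (k : nat), B A ->
    exists2 n, (k <= n)%N & A (iter n f x)) ->
  omega_limit f x = [set: X].
Proof.
move=> [_ piB] visit; apply/omega_limit_setTP => U k oU U0.
have [A BA AU] := piB U oU U0.
have [n kn An] := visit A k BA.
by exists n => //; exact: AU.
Qed.

(** This is where a pointwise visit becomes an open set of visits: the open
set provided by quasi-continuity lies in the preimage of [W], hence in its
interior. *)
Lemma quasi_continuous_interior_preimage {X Y : topologicalType} (g : X -> Y)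
    (V : set X) (W : set Y) (x : X) :
  quasi_continuous g -> open V -> open W -> V x -> W (g x) ->
  V `&` interior (g @^-1` W) !=set0.
Proof.
move=> qg oV oW Vx Wgx.
have [V' [oV' [z V'z] V'V gV'W]] := qg x W V (conj oW Wgx) (conj oV Vx).
exists z; split; first exact: V'V.
rewrite /interior /= nbhsE; exists V' => // t V't.
by apply: gV'W; exists t.
Qed.

Lemma late_visit_dense {X : topologicalType} (f : X -> X) (x : X)
    (U : set X) (k : nat) :
  (forall n, quasi_continuous (iter n f)) -> omega_limit f x = [set: X] ->
  open U -> U !=set0 ->
  dense (\bigcup_(n in [set n | (k <= n)%N]) interior (iter n f @^-1` U)).
Proof.
move=> qf /omega_limit_setTP visit oU U0 V V0 oV.
have [m _ Vm] := visit V 0%N oV V0.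
have [j mkj Uj] := visit U (m + k)%N oU U0.
have mj : (m <= j)%N := leq_trans (leq_addr k m) mkj.
have Ujm : U (iter (j - m) f (iter m f x)) by rewrite -iterD subnK.
have [z [Vz iz]] :=
  quasi_continuous_interior_preimage _ _ _ _ (qf (j - m)%N) oV oU Vm Ujm.
by exists z; split=> //; exists (j - m)%N => //=; rewrite leq_subRL.
Qed.

Lemma late_visit_Gdelta {X : topologicalType} (f : X -> X)
    (P : nat -> set X) :
  baire_space X -> pi_base (range P) ->
  (forall (U : set X) (k : nat), open U -> U !=set0 ->
    dense (\bigcup_(n in [set n | (k <= n)%N])
      interior (iter n f @^-1` U))) ->
  exists G : set X,
    [/\ Gdelta G, dense G & G `<=` [set x | omega_limit f x = [set: X]]].
Proof.
move=> baireX piP late.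
pose late_visit (p : nat * nat) : set X :=
  \bigcup_(n in [set n | (p.2 <= n)%N]) interior (iter n f @^-1` P p.1).
(* Numbers that code no pair contribute one more copy of the set of (0, 0). *)
pose F i := late_visit (odflt (0, 0)%N (unpickle i)).
have oF i : open (F i) by apply: bigcup_open => n _; exact: open_interior.
exists (\bigcap_i F i); split.
- by exists F.
- apply: baireX => i; split; first exact: oF.
  have [] := piP.1 (P (odflt (0, 0)%N (unpickle i)).1); first by eexists.
  exact: late.
- move=> x Fx; apply: (omega_limit_setT_pi_base _ _ _ piP) => _ k [i _ <-].
  have := Fx (pickle (i, k)) I; rewrite /F pickleK => -[n kn /interior_subset].
  by exists n.
Qed.

Theorem theorem4p2 (X : topologicalType) (f : X -> X) (P : nat -> set X)
  (Xf : quasi_continuous_system f)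
  (baireX : baire_space X)
  (piP : pi_base (range P)) :
  let cond1 := exists x : X, omega_limit f x = [set: X] in
  let cond2 := forall (U : set X) (k : nat), open U -> U !=set0 ->
    dense (\bigcup_(n in [set n | (k <= n)%N]) interior (iter n f @^-1` U)) in
  let cond3 := exists G : set X,
    [/\ Gdelta G, dense G & G `<=` [set x | omega_limit f x = [set: X]]] in
  (cond1 <-> cond2) /\ (cond2 <-> cond3).
Proof.
case: Xf => [[x0 _] qf] cond1 cond2 cond3.
have c12 : cond1 -> cond2.
  by move=> [x omegaT] U k oU U0; exact: (late_visit_dense _ _ _ _ qf omegaT).
have c23 : cond2 -> cond3 by exact: late_visit_Gdelta baireX piP.
have c31 : cond3 -> cond1.
  move=> [G [_ dG GT]].
  have [|x [_ Gx]] := dG [set: X] _ openT; first by exists x0.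
  by exists x; exact: GT.
by split; split=> //; [move=> /c23/c31|move=> /c31/c12].
Qed.
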